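(* On $A=M_2(\mathbb{C})$ with its standard 2D calculus, quantum metric $g=\imath(s^2\otimes s^1-s^1\otimes s^2)$ and flat quantum Levi-Civita connection $\nabla s^i=2\vartheta\otimes s^i$, the geometric data $$J=\zeta=\sigma^3,\quad C^1=\tfrac12(\sigma^1-\sigma^3),\quad C^2=\tfrac{\epsilon'}{2}(\sigma^1+\sigma^3),\quad \gamma=-\epsilon'\sigma^2,\quad \epsilon=\epsilon''=1,$$ with $\sigma_{\mathcal S}{}^i{}_j=\zeta^i{}_j[C^1,C^2]$ and inner spinor connection, is unitarily equivalent to $$C^1=\frac{1}{\sqrt2}\sigma^1,\qquad C^2=\frac{\epsilon'}{\sqrt2}\sigma^3,\qquad J=\frac{1}{\sqrt2}(\sigma^3-\sigma^1)$$ with $\gamma,\sigma_{\mathcal S}{}^i{}_j,S_i$ unchanged, and gives spectral triples of KO-dimension $n=0$ (for $\epsilon'=-1$, even with $\gamma$) and $n=1$ (for $\epsilon'=1$, ignoring $\gamma$) with $$({\not\!D}\psi)_\beta=\frac{\imath}{2\sqrt2}\Big((\sigma^1\psi_\alpha+\psi_\alpha\sigma^2)\,\sigma^{1\,\alpha}{}_\beta+\epsilon'(\psi_\alpha\sigma^1+\sigma^2\psi_\alpha)\,\sigma^{3\,\alpha}{}_\beta\Big).$$ Here Pauli matrices without spinor indices are elements of $A$ multiplying $\psi_\alpha\in A$, and those with indices ${}^\alpha{}_\beta$ act on spinor indices (sum over $\alpha$).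
   Context: **Calculus.** $\Omega^1(M_2(\mathbb{C}))$ is free with central self-adjoint basis $s^1,s^2$; with Pauli matrices $\sigma^1=\begin{pmatrix}0&1\\1&0\end{pmatrix}$, $\sigma^2=\begin{pmatrix}0&-\imath\\\imath&0\end{pmatrix}$, $\sigma^3=\begin{pmatrix}1&0\\0&-1\end{pmatrix}$ in $A$, it is inner with $da=[\vartheta,a]$, $\vartheta=\frac{\imath}{2}(\sigma^1s^1+\sigma^2s^2)$, so $da=(\partial_ia)s^i$, $\partial_i=\frac{\imath}{2}[\sigma^i,\ ]$. **Spinor data.** $\mathcal S$ is free with central basis $e^1,e^2$. Clifford action: $s^i\triangleright e^\alpha=C^{i\alpha}{}_\beta e^\beta$. Charge conjugation: $\mathcal J(ae^\alpha)=a^*J^\alpha{}_\beta e^\beta$. Even structure: $\gamma(e^\alpha)=\gamma^\alpha{}_\beta e^\beta$. Bimodule connection: $\nabla_{\mathcal S}e^\alpha=S^\alpha{}_{i\beta}s^i\otimes e^\beta$, with generalised braiding $\sigma_{\mathcal S}(e^\alpha\otimes s^j)=(\sigma_{\mathcal S}{}^j{}_i)^\alpha{}_\beta s^i\otimes e^\beta$; inner means $S_i=\frac{\imath}{2}(\sigma^i\,\mathrm{id}-\sum_j\sigma^j\sigma_{\mathcal S}{}^j{}_i)$ with $\sigma^i,\sigma^j\in A$ and $\sigma_{\mathcal S}{}^j{}_i$ matrices in spinor indices (row $\alpha$, column $\beta$). The Dirac operator is $({\not\!D}\psi)_\gamma=(\partial_i\psi_\alpha+\psi_\beta S^\beta{}_{i\alpha})C^{i\alpha}{}_\gamma$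 for $\psi=\psi_\alpha e^\alpha$. **Unitary equivalence** is a change of basis $\{e^\alpha\}$ by a constant unitary matrix $u$: $C^i\mapsto uC^iu^{-1}$, $S_i\mapsto uS_iu^{-1}$, $\sigma_{\mathcal S}{}^i{}_j\mapsto u\sigma_{\mathcal S}{}^i{}_ju^{-1}$, $J\mapsto\overline uJu^{-1}$, $\gamma\mapsto u\gamma u^{-1}$. **Spectral triple.** The Hilbert space is $\mathcal S$ with $\langle\phi_\alpha e^\alpha,\psi_\beta e^\beta\rangle=\sum_\alpha\mathrm{Tr}(\phi_\alpha^\dagger\psi_\alpha)$; $A$ acts by left multiplication. The hermitian Dirac operator is $D=\imath{\not\!D}$, $\mathcal J$ is an antilinear isometry, and the usual axioms of a finite real spectral triple hold: $[a,\mathcal Jb\mathcal J^{-1}]=0=[[D,a],\mathcal Jb\mathcal J^{-1}]$ for $a,b\in A$; $\mathcal J^2=\epsilon$; $\mathcal JD=\epsilon'_DD\mathcal J$ with $\epsilon'_D=-\epsilon'$; and in the even case a hermitian $\gamma$ commuting with $A$, with $\gamma^2=1$, $\gamma D=-D\gamma$, $\mathcal J\gamma=\epsilon''\gamma\mathcal J$. KO-dimension signs: $n=0$: $(\epsilon,\epsilon'_D,\epsilon'')=(1,1,1)$; $n=1$: $(\epsilon,\epsilon'_D)=(1,-1)$. *)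

(* Defs.v *)
From HB Require Import structures.
From mathcomp Require Export all_boot all_order all_algebra.
From mathcomp Require Export reals complex.
Set Implicit Arguments.
Unset Strict Implicit.
Unset Printing Implicit Defensive.
Import Order.TTheory GRing.Theory Num.Theory.
Local Open Scope ring_scope.
Local Open Scope sesquilinear_scope.

(* Conventions.  All indices i, j (calculus) and alpha, beta (spinor) run over
   'I_2, so the labels 1, 2 are the ordinals 0, 1.  A matrix with spinor
   indices M^alpha_beta has row alpha and column beta, hence acts on the row of
   components of psi = psi_alpha e^alpha from the right. *)

(* The algebra A = M_2(C). *)
Notation alg C := 'M[C]_2.

(* A free A-bimodule with a central basis of two elements: rows of left
   coefficients.  It serves for Omega^1 (basis s^i) and for the spinor module
   (basis e^alpha).  A tensor product over A of two such modules is again free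
   with central basis; its coefficients are 'M[alg]_2, where the row is the
   index of the first tensor factor.  The left action is the matrix scaling
   [a *: x]. *)
Notation bimod C := 'rV[alg C]_2.
Notation bimod2 C := 'M[alg C]_2.

Section Calculus.
Variable C : numClosedFieldType.
Local Notation alg := (alg C).
Local Notation bimod := (bimod C).
Local Notation bimod2 := (bimod2 C).

(* The right action: basis elements are central. *)
Definition rmul m n (x : 'M[alg]_(m, n)) (a : alg) : 'M[alg]_(m, n) :=
  map_mx (fun y => y * a) x.

Definition tens (x y : bimod) : bimod2 := \matrix_(i, j) (x 0 i * y 0 j).

Definition basis (i : 'I_2) : bimod := delta_mx 0 i.

Definition mx2 (a b c d : C) : 'M[C]_2 :=
  \matrix_(i, j) if i == 0 then (if j == 0 then a else b)
                 else (if j == 0 then c else d).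

Definition pauli1 : 'M[C]_2 := mx2 0 1 1 0.
Definition pauli2 : 'M[C]_2 := mx2 0 (- 'i) 'i 0.
Definition pauli3 : 'M[C]_2 := mx2 1 0 0 (- 1).

Definition pauli (i : 'I_2) : 'M[C]_2 := if i == 0 then pauli1 else pauli2.

Definition vartheta : bimod := \row_i (('i / 2) *: pauli i).

Definition partial (i : 'I_2) (a : alg) : alg :=
  ('i / 2) *: (pauli i * a - a * pauli i).

Definition d0 (a : alg) : bimod := rmul vartheta a - a *: vartheta.

Lemma d0E a : d0 a = \row_i partial i a.
Proof.
apply/rowP=> i; rewrite !mxE /partial scalerBr.
by rewrite -scalerAl -scalerAr.
Qed.

(* Omega^2 of the maximal prolongation is the quotient of
   Omega^1 (x)_A Omega^1 by s^1 (x) s^2 - s^2 (x) s^1.  It is modelled by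
   symmetric coefficient arrays, [wedge] being the projection; its kernel is
   the antisymmetric part, so an equation between values of [wedge] is the
   equation in Omega^2, and it also holds in every further quotient. *)
Definition wedge (x : bimod2) : bimod2 := x + x^T.

Definition d1 (w : bimod) : bimod2 :=
  wedge (tens vartheta w) + wedge (tens w vartheta).

Definition bimodule_map (f : bimod2 -> bimod2) : Prop :=
  (forall a x y, f (a *: x + y) = a *: f x + f y) /\
  (forall x a, f (rmul x a) = rmul (f x) a).

(* nabla : E -> Omega^1 (x)_A E and sg : E (x)_A Omega^1 -> Omega^1 (x)_A E. *)
Definition bimodule_connection (nabla : bimod -> bimod2)
    (sg : bimod2 -> bimod2) : Prop :=
  [/\ forall x y, nabla (x + y) = nabla x + nabla y,
      forall a x, nabla (a *: x) = tens (d0 a) x + a *: nabla x,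
      forall x a, nabla (rmul x a) = rmul (nabla x) a + sg (tens x (d0 a))
    & bimodule_map sg].

(* g = sum_ij g_ij s^i (x) s^j is central, quantum symmetric and has an inverse
   bimodule map ( , ) : Omega^1 (x)_A Omega^1 -> A, that is
   (w, g^1) g^2 = w = g^1 (g^2, w) where g = g^1 (x) g^2. *)
Definition quantum_metric (g : bimod2) : Prop :=
  [/\ forall a, a *: g = rmul g a,
      wedge g = 0
    & exists ginv : bimod2 -> alg,
      [/\ forall a x y, ginv (a *: x + y) = a * ginv x + ginv y,
          forall x a, ginv (rmul x a) = ginv x * a,
          forall w, \row_j ginv (tens w (row j g^T)) = w
        & forall w, \row_i ginv (tens (row i g) w) = w]].

(* Zero torsion: wedge o nabla = d. *)
Definition torsion_free (nabla : bimod -> bimod2) : Prop :=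
  forall w, wedge (nabla w) = d1 w.

(* nabla g = (nabla (x) id) g + (sg (x) id) (id (x) nabla) g = 0, written out
   for each k as the coefficient of (x) s^k. *)
Definition metric_compatible (g : bimod2) (nabla : bimod -> bimod2)
    (sg : bimod2 -> bimod2) : Prop :=
  forall k, nabla (row k g^T)
    + sg (\sum_j tens (row j g^T) (row k (nabla (basis j))^T)) = 0.

Definition quantum_levi_civita (g : bimod2) (nabla : bimod -> bimod2) : Prop :=
  exists sg : bimod2 -> bimod2,
    [/\ bimodule_connection nabla sg, torsion_free nabla
      & metric_compatible g nabla sg].

(* Zero curvature (d (x) id - id /\ nabla) nabla = 0, for each k as the
   coefficient of (x) s^k. *)
Definition flat (nabla : bimod -> bimod2) : Prop :=
  forall w k, d1 (row k (nabla w)^T)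
    - \sum_j wedge (tens (row j (nabla w)^T) (row k (nabla (basis j))^T)) = 0.

Definition metric_M2 : bimod2 :=
  ('i)%:M *: (tens (basis 1) (basis 0) - tens (basis 0) (basis 1)).

(* nabla s^i = 2 vartheta (x) s^i, extended by the left Leibniz rule. *)
Definition nabla_M2 (w : bimod) : bimod2 :=
  \sum_i (tens (d0 (w 0 i)) (basis i)
          + w 0 i *: (tens (vartheta *+ 2) (basis i))).

End Calculus.

Section Spinors.
Variable C : numClosedFieldType.
Local Notation alg := (alg C).
Local Notation spinor := (bimod C).

(* [cliff i] = C^i, [conn i] = S_i, [braid j i] = sigma_S^j_i (upper index
   first), [cconj] = J, [grad] = gamma. *)
Record spinor_data := SpinorData {
  cliff : 'I_2 -> 'M[C]_2;
  conn : 'I_2 -> 'M[alg]_2;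
  braid : 'I_2 -> 'I_2 -> 'M[C]_2;
  cconj : 'M[C]_2;
  grad : 'M[C]_2 }.

Definition inner_conn (sS : 'I_2 -> 'I_2 -> 'M[C]_2) (i : 'I_2) : 'M[alg]_2 :=
  \matrix_(al, be) (('i / 2) *:
    ((al == be)%:R *: pauli C i - \sum_j sS j i al be *: pauli C j)).

Variable X : spinor_data.

Definition nablaS (psi : spinor) : bimod2 C :=
  \matrix_(i, al) (partial i (psi 0 al) + \sum_be psi 0 be * conn X i be al).

Definition braidS (x : bimod2 C) : bimod2 C :=
  \matrix_(i, be) \sum_al \sum_j braid X j i al be *: x al j.

(* The Clifford action Omega^1 (x)_A S -> S. *)
Definition clifford (x : bimod2 C) : spinor :=
  \row_ga \sum_i \sum_al cliff X i al ga *: x i al.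

Definition dirac (psi : spinor) : spinor := clifford (nablaS psi).

Lemma diracE psi ga : dirac psi 0 ga =
  \sum_i \sum_al cliff X i al ga *:
    (partial i (psi 0 al) + \sum_be psi 0 be * conn X i be al).
Proof.
by rewrite mxE; apply: eq_bigr => i _; apply: eq_bigr => al _; rewrite mxE.
Qed.

Definition charge_conj (psi : spinor) : spinor :=
  \row_be \sum_al cconj X al be *: (psi 0 al)^t*.

Definition gamma (psi : spinor) : spinor :=
  \row_be \sum_al grad X al be *: psi 0 al.

(* The hermitian operator D = i Dslash. *)
Definition diracD (psi : spinor) : spinor := ('i)%:M *: dirac psi.

End Spinors.

Definition unitarily_equivalent (C : numClosedFieldType) (X Y : spinor_data C)
    : Prop :=
  exists2 u : 'M[C]_2, u \is unitarymx &
    let uA : 'M[alg C]_2 := map_mx (fun z => z%:M) u in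
    let uAinv : 'M[alg C]_2 := map_mx (fun z => z%:M) (invmx u) in
    [/\ forall i, cliff Y i = u *m cliff X i *m invmx u,
        forall i, conn Y i = uA *m conn X i *m uAinv,
        forall i j, braid Y i j = u *m braid X i j *m invmx u,
        cconj Y = map_mx Num.conj u *m cconj X *m invmx u
      & grad Y = u *m grad X *m invmx u].

Section SpectralTriple.
Variable C : numClosedFieldType.
Local Notation alg := (alg C).
Local Notation spinor := (bimod C).
Implicit Types D J T : spinor -> spinor.

Definition hip (phi psi : spinor) : C :=
  \sum_al \tr ((phi 0 al)^t* *m psi 0 al).

(* Complex scalars act on spinors through z%:M : alg. *)
Definition clinear T : Prop :=
  forall (z : C) x y, T (z%:M *: x + y) = z%:M *: T x + T y.

Definition antilinear T : Prop :=
  forall (z : C) x y, T (z%:M *: x + y) = (z^*)%:M *: T x + T y.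

Definition self_adjoint T : Prop := forall x y, hip (T x) y = hip x (T y).

Definition antiisometry T : Prop := forall x y, hip (T x) (T y) = hip y x.

Definition opcomm T T' : spinor -> spinor := fun x => T (T' x) - T' (T x).

Definition lmult (a : alg) : spinor -> spinor := fun x => a *: x.

Definition real_spectral_triple (eps epsD : C) D J : Prop :=
  [/\ clinear D /\ self_adjoint D,
      antilinear J /\ antiisometry J,
      exists Jinv : spinor -> spinor,
        [/\ cancel J Jinv, cancel Jinv J,
            forall a b x, opcomm (lmult a) (J \o lmult b \o Jinv) x = 0
          & forall a b x,
              opcomm (opcomm D (lmult a)) (J \o lmult b \o Jinv) x = 0],
      forall x, J (J x) = eps%:M *: x
    & forall x, J (D x) = epsD%:M *: D (J x)].

Definition even_structure (eps'' : C) D J (G : spinor -> spinor) : Prop :=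
  [/\ clinear G /\ self_adjoint G,
      forall a x, G (a *: x) = a *: G x,
      forall x, G (G x) = x,
      forall x, G (D x) = - D (G x)
    & forall x, J (G x) = eps''%:M *: G (J x)].

Definition spectral_triple_KO0 D J (G : spinor -> spinor) : Prop :=
  real_spectral_triple 1 1 D J /\ even_structure 1 D J G.

Definition spectral_triple_KO1 D J : Prop := real_spectral_triple 1 (-1) D J.

End SpectralTriple.

Section Data.
Variables (C : numClosedFieldType) (eps' : C).

Definition zeta : 'M[C]_2 := pauli3 C.

Definition cliff_a (i : 'I_2) : 'M[C]_2 :=
  if i == 0 then 2^-1 *: (pauli1 C - pauli3 C)
  else (eps' / 2) *: (pauli1 C + pauli3 C).

Definition braid_a (i j : 'I_2) : 'M[C]_2 :=
  zeta i j *: (cliff_a 0 * cliff_a 1 - cliff_a 1 * cliff_a 0).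

Definition data_a : spinor_data C :=
  {| cliff := cliff_a;
     conn := inner_conn braid_a;
     braid := braid_a;
     cconj := zeta;
     grad := - eps' *: pauli2 C |}.

Definition data_b : spinor_data C :=
  {| cliff := fun i => if i == 0 then (sqrtC 2)^-1 *: pauli1 C
                       else (eps' / sqrtC 2) *: pauli3 C;
     conn := conn data_a;
     braid := braid data_a;
     cconj := (sqrtC 2)^-1 *: (pauli3 C - pauli1 C);
     grad := grad data_a |}.

End Data.

(* Main.v *)
From HB Require Import structures.
Require Import Defs.
From mathcomp Require Import ring.
Set Implicit Arguments.
Unset Strict Implicit.
Unset Printing Implicit Defensive.
Import Order.TTheory GRing.Theory Num.Theory.
Local Open Scope ring_scope.

(** Everything is inner, which turns the geometry into statements about the
    one-form theta.  If sg is a bimodule map, then x |-> theta (x) x -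
    sg (x (x) theta) is a bimodule connection with generalised braiding sg,
    because da = [theta, a] ([inner_bimodule_connection]).  On one-forms
    nabla s^i = 2 theta (x) s^i is of this kind, with minus the flip as
    braiding.  Torsion and metric compatibility then hold by cancellation,
    and the curvature is the commutator with the elements theta_i theta_j +
    theta_j theta_i, which are scalars since Pauli matrices anticommute up to
    scalars ([nabla_M2_flat]).  The coefficients of g form the scalar matrix
    sigma^2, an involution, so g is its own inverse.

    Write C^0, C^1 for the two Clifford matrices.  Both sets of spinor data
    satisfy the same relations ([real_clifford]): C^0 and C^1 are hermitian,
    anticommute and have square 1/2, J is a real symmetric involution with
    conj(C^0) J = - eps' J C^1, and sigma_S, gamma are multiples of
    K = [C^0, C^1].  These relations imply all the axioms, so that
    the two data are treated at once.  From K C^0 = - C^1 and K C^1 = C^0 the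
    Dirac operator takes, with h_i = - sigma^i / 2, the symmetric form
      D psi = (h_0 psi + psi h_1) C^0 + (h_1 psi + psi h_0) C^1
    ([diracD_swap]), in which A multiplies on both sides and the C^i act on
    the spinor index.  All factors being hermitian, D is self-adjoint.
    The antilinear map J exchanges left and right multiplications, hence the
    two brackets, and it exchanges C^0 and C^1 at the cost of a factor - eps':
    this is J D = - eps' D J ([charge_conj_diracD]), the only place where the
    sign eps' decides the KO-dimension.  Moreover J b J^-1 is the right
    multiplication by the adjoint of b, whereas [D, a] only involves left
    multiplications, which gives the order conditions.  Finally gamma = - i K
    anticommutes with C^0 and C^1.

    The change of basis is the rotation of angle pi / 8, namely
    cos (pi / 8) + i sin (pi / 8) sigma^2.  It is real, it commutes with
    sigma^2 and so fixes gamma, sigma_S and S_i, and it acts on the plane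
    spanned by sigma^1 and sigma^3 as a rotation by pi / 4
    ([data_unitarily_equivalent]). *)

(** * Two by two matrices *)

Lemma ord2_ind (P : 'I_2 -> Prop) : P 0 -> P 1 -> forall i, P i.
Proof.
move=> P0 P1 [[|[|//]] lt_i]; [move: P0 | move: P1]; congr P; exact: val_inj.
Qed.

Lemma sum_ord2 (V : nmodType) (F : 'I_2 -> V) : \sum_i F i = F 0 + F 1.
Proof.
by rewrite big_ord_recl big_ord1; congr (_ + F _); apply: val_inj.
Qed.

Section PauliArithmetic.
Local Open Scope sesquilinear_scope.
Variable C : numClosedFieldType.
Implicit Types a b c d x : C.

Lemma mx2_map (f : C -> C) a b c d :
  map_mx f (mx2 a b c d) = mx2 (f a) (f b) (f c) (f d).
Proof. by apply/matrixP; elim/ord2_ind; elim/ord2_ind; rewrite !mxE. Qed.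

Lemma mx2_tr a b c d : (mx2 a b c d)^T = mx2 a c b d.
Proof. by apply/matrixP; elim/ord2_ind; elim/ord2_ind; rewrite !mxE. Qed.

Lemma mx2N a b c d : - mx2 a b c d = mx2 (- a) (- b) (- c) (- d).
Proof. by apply/matrixP; elim/ord2_ind; elim/ord2_ind; rewrite !mxE. Qed.

Lemma mx2Z x a b c d : x *: mx2 a b c d = mx2 (x * a) (x * b) (x * c) (x * d).
Proof. by apply/matrixP; elim/ord2_ind; elim/ord2_ind; rewrite !mxE. Qed.

Lemma mx2D a b c d a' b' c' d' :
  mx2 a b c d + mx2 a' b' c' d' = mx2 (a + a') (b + b') (c + c') (d + d').
Proof. by apply/matrixP; elim/ord2_ind; elim/ord2_ind; rewrite !mxE. Qed.

Lemma mx2M a b c d a' b' c' d' :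
  mx2 a b c d *m mx2 a' b' c' d' =
  mx2 (a * a' + b * c') (a * b' + b * d') (c * a' + d * c') (c * b' + d * d').
Proof.
by apply/matrixP; elim/ord2_ind; elim/ord2_ind;
  rewrite !mxE sum_ord2 !mxE.
Qed.

Lemma mx2_scalar x : x%:M = mx2 x 0 0 x.
Proof. by apply/matrixP; elim/ord2_ind; elim/ord2_ind; rewrite !mxE. Qed.

Definition mx2E :=
  (mx2_scalar, mx2_map, mx2_tr, mx2Z, mx2M, mx2N, mx2D).

Lemma Ci_sq : 'i * 'i = - 1 :> C. Proof. by rewrite -expr2 sqrCi. Qed.

(** The algebra product and [*m] are convertible but not syntactically equal:
    this moves a product to the form expected by [mx2M]. *)
Lemma mul_algE (a b : alg C) : a * b = a *m b. Proof. by []. Qed.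

Lemma pauli2_sq : pauli2 C *m pauli2 C = 1%:M.
Proof. by rewrite ?mx2E; congr mx2; ring: Ci_sq. Qed.

End PauliArithmetic.

(** * Bimodules with a central basis *)

Section CentralBasis.
Local Open Scope sesquilinear_scope.
Variable C : numClosedFieldType.
Local Notation alg := (alg C).
Local Notation bimod := (bimod C).
Local Notation bimod2 := (bimod2 C).

(** Constant matrices act on the index of the basis, commuting with both actions
    of the algebra. *)
Definition central m n (M : 'M[C]_(m, n)) : 'M[alg]_(m, n) :=
  map_mx (fun z => z%:M) M.

Lemma centralE m n (M : 'M[C]_(m, n)) i j : central M i j = (M i j)%:M.
Proof. by rewrite mxE. Qed.

Lemma central1 n : central 1%:M = 1%:M :> 'M[alg]_n.
Proof. exact: (map_mx1 (@scalar_mx C 2)). Qed.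

Lemma centralM m n p (M : 'M[C]_(m, n)) (N : 'M[C]_(n, p)) :
  central (M *m N) = central M *m central N.
Proof. exact: (map_mxM (@scalar_mx C 2)). Qed.

Lemma central0 m n : central (0 : 'M[C]_(m, n)) = 0.
Proof. exact: (map_mx0 (@scalar_mx C 2)). Qed.

Lemma centralN m n (M : 'M[C]_(m, n)) : central (- M) = - central M.
Proof. exact: (map_mxN (@scalar_mx C 2)). Qed.

Lemma scale_algE c (a : alg) : c%:M * a = c *: a.
Proof. by rewrite mul_algE mul_scalar_mx. Qed.

Lemma scale_algEr c (a : alg) : a * c%:M = c *: a.
Proof. by rewrite mul_algE mul_mx_scalar. Qed.

Lemma mulmx_centralE m n p (x : 'M[alg]_(m, n)) (M : 'M[C]_(n, p)) i j :
  (x *m central M) i j = \sum_k M k j *: x i k.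
Proof. by rewrite mxE; apply: eq_bigr => k _; rewrite centralE scale_algEr. Qed.

Lemma mulmx_centralZ m n p (x : 'M[alg]_(m, n)) c (M : 'M[C]_(n, p)) :
  x *m central (c *: M) = c%:M *: (x *m central M).
Proof.
apply/matrixP => i j; rewrite [RHS]mxE !mulmx_centralE scale_algE scaler_sumr.
by apply: eq_bigr => k _; rewrite mxE scalerA.
Qed.

Lemma central_mulZ m n p (M : 'M[C]_(m, n)) a (x : 'M[alg]_(n, p)) :
  central M *m (a *: x) = a *: (central M *m x).
Proof.
apply/matrixP => i j; rewrite !mxE mulr_sumr; apply: eq_bigr => k _.
by rewrite !mxE !scale_algE scalerAr.
Qed.

Lemma sub_mxE m n (x y : 'M[alg]_(m, n)) i j : (x - y) i j = x i j - y i j.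
Proof. by rewrite mxE [(- y) i j]mxE. Qed.

Lemma tensE (x y : bimod) i j : tens x y i j = x 0 i * y 0 j.
Proof. by rewrite mxE. Qed.

Lemma rmulD m n (x y : 'M[alg]_(m, n)) a : rmul (x + y) a = rmul x a + rmul y a.
Proof. by apply/matrixP => i j; rewrite !mxE mulrDl. Qed.

Lemma rmulN m n (x : 'M[alg]_(m, n)) a : rmul (- x) a = - rmul x a.
Proof. by apply/matrixP => i j; rewrite !mxE mulNr. Qed.

Lemma rmulB m n (x y : 'M[alg]_(m, n)) a : rmul (x - y) a = rmul x a - rmul y a.
Proof. by rewrite rmulD rmulN. Qed.

Lemma rmulZ m n (x : 'M[alg]_(m, n)) a b : rmul (a *: x) b = a *: rmul x b.
Proof. by apply/matrixP => i j; rewrite !mxE mulrA. Qed.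

Lemma rmulA m n (x : 'M[alg]_(m, n)) a b : rmul (rmul x a) b = rmul x (a * b).
Proof. by apply/matrixP => i j; rewrite !mxE mulrA. Qed.

Lemma rmulC m n (x : 'M[alg]_(m, n)) c : rmul x c%:M = c%:M *: x.
Proof. by apply/matrixP => i j; rewrite !mxE scale_algE scale_algEr. Qed.

Lemma rmul_central m n p (x : 'M[alg]_(m, n)) (M : 'M[C]_(n, p)) a :
  rmul (x *m central M) a = rmul x a *m central M.
Proof.
apply/matrixP => i j; rewrite [LHS]mxE !mulmx_centralE mulr_suml.
by apply: eq_bigr => k _; rewrite !mxE scalerAl.
Qed.

Lemma tensDl (x y z : bimod) : tens (x + y) z = tens x z + tens y z.
Proof. by apply/matrixP => i j; rewrite !mxE mulrDl. Qed.

Lemma tensDr (x y z : bimod) : tens x (y + z) = tens x y + tens x z.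
Proof. by apply/matrixP => i j; rewrite !mxE mulrDr. Qed.

Lemma tensNl (x y : bimod) : tens (- x) y = - tens x y.
Proof. by apply/matrixP => i j; rewrite !mxE mulNr. Qed.

Lemma tensNr (x y : bimod) : tens x (- y) = - tens x y.
Proof. by apply/matrixP => i j; rewrite !mxE mulrN. Qed.

Lemma tensZl a (x y : bimod) : tens (a *: x) y = a *: tens x y.
Proof. by apply/matrixP => i j; rewrite !mxE mulrA. Qed.

Lemma tensZr a (x y : bimod) : tens x (a *: y) = tens (rmul x a) y.
Proof. by apply/matrixP => i j; rewrite !mxE mulrA. Qed.

Lemma tens_rmul a (x y : bimod) : tens x (rmul y a) = rmul (tens x y) a.
Proof. by apply/matrixP => i j; rewrite !mxE mulrA. Qed.

Lemma tens0r (x : bimod) : tens x 0 = 0.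
Proof. by apply/matrixP => i j; rewrite !mxE mulr0. Qed.

(** The left Leibniz rule is theta (x) a x = (da + a theta) (x) x; for the right
    one, x a (x) theta = x (x) a theta equals
    (x (x) theta) a - x (x) da. *)
Lemma inner_bimodule_connection (nabla : bimod -> bimod2)
    (sg : bimod2 -> bimod2) :
    bimodule_map sg ->
    (forall x, nabla x = tens (vartheta C) x - sg (tens x (vartheta C))) ->
  bimodule_connection nabla sg.
Proof.
move=> sgP nablaE; have [sgL sgR] := sgP.
have sgD x y : sg (x + y) = sg x + sg y.
  by have := sgL 1 x y; rewrite !scale1r.
have sg0 : sg 0 = 0 by apply: (addrI (sg 0)); rewrite -sgD !addr0.
have sgZ a x : sg (a *: x) = a *: sg x by rewrite -[a *: x]addr0 sgL sg0 addr0.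
have sgN x : sg (- x) = - sg x.
  by apply/eqP; rewrite -addr_eq0 -sgD addNr sg0.
split=> // [x y | a x | x a]; rewrite !nablaE.
- by rewrite tensDl tensDr sgD opprD addrACA.
- rewrite tensZl sgZ /d0 tensDl tensNl tensZl -tensZr scalerBr.
  by rewrite addrA subrK.
- rewrite rmulB -sgR -!tens_rmul /d0 tensDr tensNr tensZr sgD sgN.
  by rewrite addrA subrK.
Qed.

End CentralBasis.

(** * The flat quantum Levi-Civita connection *)

Section Geometry.
Variable C : numClosedFieldType.
Local Notation alg := (alg C).
Local Notation bimod := (bimod C).
Local Notation bimod2 := (bimod2 C).
Local Notation theta := (vartheta C).

(** The generalised braiding of the Levi-Civita connection, with its sign. *)
Definition flip (x : bimod2) : bimod2 := - x^T.

Lemma flip_bimodule_map : bimodule_map flip.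
Proof.
split=> [a x y | x a]; apply/matrixP => i j; rewrite !mxE.
  by rewrite opprD mulrN.
by rewrite mulNr.
Qed.

Lemma nabla_M2E w : nabla_M2 w = tens theta w - flip (tens w theta).
Proof.
apply/matrixP => l k; rewrite /flip opprK /nabla_M2 summxE (bigD1 k) //=.
rewrite big1 ?addr0 => [|i neq_ik].
  rewrite d0E !mxE !eqxx !mulr1 /partial.
  set t := 'i / 2; rewrite scalerBr.
  by rewrite mulrDr -scalerAl -scalerAr addrA subrK.
by rewrite !mxE eq_sym (negPf neq_ik) !mulr0 addr0.
Qed.

Lemma nabla_M2_coef w l k :
  nabla_M2 w l k = theta 0 l * w 0 k + w 0 k * theta 0 l.
Proof. by rewrite nabla_M2E /flip opprK !mxE. Qed.

Lemma nabla_M2_connection : bimodule_connection (@nabla_M2 C) flip.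
Proof.
exact: inner_bimodule_connection flip_bimodule_map nabla_M2E.
Qed.

Lemma nabla_M2_torsion_free : torsion_free (@nabla_M2 C).
Proof.
move=> w; apply/matrixP => i j; rewrite /d1 /wedge !mxE !nabla_M2_coef !mxE.
by rewrite [LHS]addrACA [X in _ + X = _]addrC.
Qed.

Lemma metric_M2E : metric_M2 C = central (pauli2 C).
Proof.
apply/matrixP; elim/ord2_ind; elim/ord2_ind; rewrite !mxE /= !scale_algE;
by rewrite !(mulr0, mulr1, mul0r, subr0, sub0r, subrr, scaler0, scalerN,
             mul1r, raddfN, raddf0) //= ?scalemx1.
Qed.

(** The inverse metric has the same coefficients as g, because sigma^2 is an
    involution; the two inversion identities are the two ways of contracting
    sigma^2 with itself. *)
Lemma metric_M2_quantum_metric : quantum_metric (metric_M2 C).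
Proof.
rewrite metric_M2E; split.
- by move=> a; apply/matrixP => i j; rewrite !mxE scale_algE scale_algEr.
- apply/matrixP; elim/ord2_ind; elim/ord2_ind; rewrite !mxE /= -?raddfD /=;
    by rewrite ?addr0 ?addNr ?subrr raddf0.
pose h := pauli2 C; have hh : h *m h = 1%:M by exact: pauli2_sq.
exists (fun x => \sum_i \sum_k h i k *: x i k); split.
- move=> a x y; rewrite mulr_sumr -big_split; apply: eq_bigr => i _ /=.
  rewrite mulr_sumr -big_split; apply: eq_bigr => k _ /=.
  by rewrite !mxE scalerDr scalerAr.
- move=> x a; rewrite mulr_suml; apply: eq_bigr => i _.
  by rewrite mulr_suml; apply: eq_bigr => k _; rewrite !mxE scalerAl.
- move=> w; transitivity (w *m central (h *m h)).
    apply/rowP => j; rewrite mxE mulmx_centralE; apply: eq_bigr => i _.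
    rewrite mxE scaler_suml; apply: eq_bigr => k _.
    by rewrite !mxE scale_algEr scalerA.
  by rewrite hh central1 mulmx1.
- move=> w; transitivity (w *m central (h *m h)^T).
    apply/rowP => i; rewrite mxE mulmx_centralE exchange_big.
    apply: eq_bigr => k _ /=.
    rewrite !mxE scaler_suml; apply: eq_bigr => j _.
    by rewrite !mxE scale_algE scalerA mulrC.
  by rewrite hh trmx1 central1 mulmx1.
Qed.

Lemma nabla_M2_basis j k :
  row k (nabla_M2 (basis C j))^T = (j == k)%:R *: (theta *+ 2).
Proof.
apply/rowP => l; rewrite mxE mxE nabla_M2_coef [basis C j 0 k]mxE eqxx eq_sym.
rewrite mulr2n scalerDr; case: (j == k) => /=.
  by rewrite -[1%:R]/(1 : alg) scale1r mulr1 mul1r [RHS]mxE.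
by rewrite scale0r mulr0 mul0r !addr0 mxE.
Qed.

(** The form in which nabla s^j = 2 theta (x) s^j enters both metric
    compatibility and curvature. *)
Lemma sum_nabla_M2_basis (F : {additive bimod2 -> bimod2})
    (x : 'I_2 -> bimod) k :
  \sum_j F (tens (x j) (row k (nabla_M2 (basis C j))^T)) =
    F (tens (x k) (theta *+ 2)).
Proof.
rewrite (bigD1 k) //= big1 ?addr0 => [|j /negPf neq_jk].
  by rewrite nabla_M2_basis eqxx scale1r.
by rewrite nabla_M2_basis neq_jk -[0%:R]/(0 : alg) scale0r tens0r raddf0.
Qed.

Lemma nabla_M2_metric : metric_compatible (metric_M2 C) (@nabla_M2 C) flip.
Proof.
move=> k; rewrite (sum_nabla_M2_basis idfun (fun j => row j _)) /=.
apply/matrixP => l m; rewrite metric_M2E mxE nabla_M2_coef /flip !mxE.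
by rewrite !scale_algE !scale_algEr scalerDr subrr.
Qed.

Lemma vartheta_anticommute i j :
  theta 0 i * theta 0 j + theta 0 j * theta 0 i = (- (i == j)%:R / 2)%:M.
Proof.
move: i j; elim/ord2_ind; elim/ord2_ind; rewrite !mxE /= !mul_algE ?mx2E;
  by congr mx2; field: (Ci_sq C).
Qed.

Lemma wedge_is_zmod_morphism : zmod_morphism (@wedge C).
Proof. by move=> x y; rewrite /wedge linearB opprD addrACA. Qed.

HB.instance Definition _ :=
  GRing.isZmodMorphism.Build bimod2 bimod2 (@wedge C) wedge_is_zmod_morphism.

Lemma wedgeE (x : bimod2) i j : wedge x i j = x i j + x j i.
Proof. by rewrite mxE [x^T i j]mxE. Qed.

(** The noncommutative identity behind flatness: the left-hand side is the
    coefficient of the curvature of a form with component c, where s and t are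
    theta_i and theta_j. *)
Lemma anticommutator_commutator (S : nzRingType) (s t c : S) :
  s * (t * c + c * t) - (s * c + c * s) * t
    + (t * (s * c + c * s) - (t * c + c * t) * s) =
  (s * t + t * s) * c - c * (s * t + t * s).
Proof.
have half a b :
    a * (b * c + c * b) - (a * c + c * a) * b = a * b * c - c * (a * b).
  by rewrite mulrDr mulrDl !mulrA opprD addrA addrK.
by rewrite !half [in RHS]mulrDl mulrDr opprD addrACA.
Qed.

Lemma nabla_M2_flat : flat (@nabla_M2 C).
Proof.
move=> w k; rewrite (sum_nabla_M2_basis (@wedge C) (fun j => row j _)) /=.
set v := row k _; set c := w 0 k.
have vE l : v 0 l = theta 0 l * c + c * theta 0 l.
  by rewrite mxE mxE nabla_M2_coef.
(* d1 v = theta /\ v + v /\ theta, so one of the two copies of v /\ theta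
   survives with a minus sign. *)
have -> : tens v (theta *+ 2) = tens v theta + tens v theta.
  by rewrite mulr2n tensDr.
rewrite /d1 [wedge (_ + _)]raddfD opprD addrA addrK -raddfB.
apply/matrixP => i j; rewrite wedgeE !sub_mxE !tensE !vE.
rewrite anticommutator_commutator.
by rewrite vartheta_anticommute scale_algE scale_algEr subrr mxE.
Qed.

End Geometry.

(** * Adjoints for the hermitian product of spinors *)

Section Hilbert.
Local Open Scope sesquilinear_scope.
Variable C : numClosedFieldType.
Local Notation alg := (alg C).
Local Notation spinor := (bimod C).
Implicit Types (x y : spinor) (a b : alg) (M : 'M[C]_2).

Lemma trmxC_mul m n p (M : 'M[C]_(m, n)) (N : 'M[C]_(n, p)) :
  (M *m N)^t* = N^t* *m M^t*.
Proof. by rewrite trmx_mul map_mxM. Qed.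

Lemma trmxCD m n (M N : 'M[C]_(m, n)) : (M + N)^t* = M^t* + N^t*.
Proof. by rewrite linearD map_mxD. Qed.

Lemma trmxCZ m n c (M : 'M[C]_(m, n)) : (c *: M)^t* = c^* *: M^t*.
Proof. by rewrite linearZ map_mxZ. Qed.

Lemma trmxCN m n (M : 'M[C]_(m, n)) : (- M)^t* = - M^t*.
Proof. by rewrite linearN map_mxN. Qed.

Definition star (x : spinor) : spinor := map_mx (fun a : alg => a^t*) x.

Lemma starK : involutive star.
Proof. by move=> x; apply/rowP => i; rewrite !mxE trmxCK. Qed.

Lemma starD x y : star (x + y) = star x + star y.
Proof. by apply/rowP => i; rewrite !mxE trmxCD. Qed.

Lemma starZ a x : star (a *: x) = rmul (star x) (a^t*).
Proof. by apply/rowP => i; rewrite !mxE trmxC_mul. Qed.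

Lemma star_rmul a x : star (rmul x a) = a^t* *: star x.
Proof. by apply/rowP => i; rewrite !mxE trmxC_mul. Qed.

Lemma star_central M x :
  star (x *m central M) = star x *m central (map_mx Num.conj M).
Proof.
apply/rowP => j; rewrite mxE !mulmx_centralE.
rewrite linear_sum raddf_sum; apply: eq_bigr => i _ /=.
by rewrite trmxCZ !mxE.
Qed.

Lemma hipDl x x' y : hip (x + x') y = hip x y + hip x' y.
Proof.
rewrite /hip -big_split; apply: eq_bigr => i _ /=.
by rewrite mxE trmxCD mulmxDl mxtraceD.
Qed.

Lemma hipDr x y y' : hip x (y + y') = hip x y + hip x y'.
Proof.
rewrite /hip -big_split; apply: eq_bigr => i _ /=.
by rewrite mxE mulmxDr mxtraceD.
Qed.

Lemma hip_lmult a x y : hip (a *: x) y = hip x (a^t* *: y).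
Proof.
by apply: eq_bigr => i _; rewrite !mxE trmxC_mul -mulmxA.
Qed.

Lemma hip_rmul a x y : hip (rmul x a) y = hip x (rmul y (a^t*)).
Proof.
apply: eq_bigr => i _; rewrite !mxE trmxC_mul -mulmxA mxtrace_mulC.
by rewrite -mulmxA.
Qed.

Lemma hip_central M x y : hip (x *m central M) y = hip x (y *m central (M^t*)).
Proof.
rewrite /hip; under eq_bigr do
  rewrite mulmx_centralE linear_sum raddf_sum mulmx_suml raddf_sum /=.
rewrite exchange_big; apply: eq_bigr => i _ /=.
rewrite mulmx_centralE mulmx_sumr raddf_sum; apply: eq_bigr => j _ /=.
by rewrite trmxCZ -scalemxAl -scalemxAr !mxE.
Qed.

Lemma hip_star x y : hip (star x) (star y) = hip y x.
Proof.
by apply: eq_bigr => i _; rewrite !mxE trmxCK mxtrace_mulC.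
Qed.

End Hilbert.

(** * Inner spinor connections *)

Section InnerSpinorConnection.
Variable C : numClosedFieldType.
Local Notation theta := (vartheta C).

Lemma inner_connE (sS : 'I_2 -> 'I_2 -> 'M[C]_2) i :
  inner_conn sS i = theta 0 i *: 1%:M
    - \sum_j theta 0 j *: central (sS j i).
Proof.
apply/matrixP => al be; rewrite sub_mxE summxE mxE scalerBr scaler_sumr.
congr (_ - _).
  by rewrite !mxE; case: (al == be);
    rewrite ?(mulr1, mulr0, scale1r, scale0r, scaler0).
apply: eq_bigr => j _.
by rewrite [RHS]mxE centralE scale_algEr [vartheta _ _ _]mxE !scalerA mulrC.
Qed.

(** A constant change of basis commutes with theta, so it only affects the
    braiding. *)
Lemma inner_conn_conjugate (sS : 'I_2 -> 'I_2 -> 'M[C]_2) (u v : 'M[C]_2) i :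
    u *m v = 1%:M ->
  central u *m inner_conn sS i *m central v =
  inner_conn (fun j k => u *m sS j k *m v) i.
Proof.
move=> uv; rewrite !inner_connE mulmxBr mulmxBl; congr (_ - _).
  by rewrite central_mulZ mulmx1 -scalemxAl -centralM uv central1.
rewrite mulmx_sumr mulmx_suml; apply: eq_bigr => j _.
by rewrite central_mulZ -scalemxAl !centralM.
Qed.

Variable X : spinor_data C.

Lemma braidS_bimodule_map : bimodule_map (braidS X).
Proof.
split=> [a x y | x a]; apply/matrixP => i be; rewrite !mxE.
  rewrite mulr_sumr -big_split; apply: eq_bigr => al _ /=.
  rewrite mulr_sumr -big_split; apply: eq_bigr => j _ /=.
  by rewrite !mxE scalerDr scalerAr.
rewrite mulr_suml; apply: eq_bigr => al _.
by rewrite mulr_suml; apply: eq_bigr => j _; rewrite !mxE scalerAl.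
Qed.

Hypothesis connE : forall i, conn X i = inner_conn (braid X) i.

Lemma nablaS_inner psi :
  nablaS X psi = tens theta psi - braidS X (tens psi theta).
Proof.
apply/matrixP => i al; rewrite [LHS]mxE sub_mxE tensE /partial.
under eq_bigr => be _.
  rewrite connE [inner_conn _ _ _ _]mxE -scalerAr mulrBr scalerBr mulr_sumr.
  rewrite scaler_sumr; over.
rewrite sumrB.
have -> : \sum_be ('i / 2) *: (psi 0 be * ((be == al)%:R *: pauli C i)) =
          ('i / 2) *: (psi 0 al * pauli C i).
  rewrite (bigD1 al) //= eqxx scale1r big1 ?addr0 // => be /negPf ->.
  by rewrite scale0r mulr0 scaler0.
rewrite scalerBr addrA subrK scalerAl [theta 0 i]mxE; congr (_ - _).
rewrite [RHS]mxE; apply: eq_bigr => be _; apply: eq_bigr => j _.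
by rewrite tensE [theta 0 j]mxE -!scalerAr !scalerA mulrC.
Qed.

Lemma nablaS_connection : bimodule_connection (nablaS X) (braidS X).
Proof.
exact: inner_bimodule_connection braidS_bimodule_map nablaS_inner.
Qed.

(** Clifford multiplication applied to theta (x) psi - sigma_S (psi (x) theta):
    the first term multiplies psi by theta on the left, the second on the
    right. *)
Lemma dirac_inner psi :
  dirac X psi = \sum_i (theta 0 i *: psi) *m central (cliff X i)
    - \sum_i \sum_j rmul psi (theta 0 j) *m central (braid X j i *m cliff X i).
Proof.
rewrite /dirac nablaS_inner.
apply/rowP => ga; rewrite sub_mxE !summxE mxE -sumrB; apply: eq_bigr => i _.
rewrite summxE mulmx_centralE.
under eq_bigr do rewrite sub_mxE scalerBr tensE.
rewrite sumrB; congr (_ - _).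
  by apply: eq_bigr => al _; rewrite [(_ *: psi) _ _]mxE.
under [RHS]eq_bigr do rewrite centralM mulmxA mulmx_centralE.
rewrite [RHS]exchange_big; apply: eq_bigr => al _ /=.
rewrite -scaler_sumr; congr (_ *: _).
rewrite mxE exchange_big; apply: eq_bigr => j _ /=.
rewrite mulmx_centralE; apply: eq_bigr => be _.
by rewrite tensE [rmul _ _ _ _]mxE.
Qed.

End InnerSpinorConnection.

(** * Spectral triples from the Clifford relations *)

Section CliffordRelations.
Local Open Scope sesquilinear_scope.
Variable C : numClosedFieldType.
Local Notation alg := (alg C).
Local Notation spinor := (bimod C).
Local Notation theta := (vartheta C).

Definition commutator (M N : 'M[C]_2) : 'M[C]_2 := M *m N - N *m M.

(** The relations common to the two sets of data and sufficient for the axioms of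
    a spectral triple; e stands for the sign eps'. *)
Record real_clifford (e : C) (X : spinor_data C) : Prop := RealClifford {
  cliff_herm : forall i, (cliff X i)^t* = cliff X i;
  cliff_sq : forall i, cliff X i *m cliff X i = 2^-1%:M;
  cliff_anti : cliff X 0 *m cliff X 1 = - (cliff X 1 *m cliff X 0);
  braid_comm : forall i j,
    braid X i j = zeta C i j *: commutator (cliff X 0) (cliff X 1);
  conn_inner : forall i, conn X i = inner_conn (braid X) i;
  cconj_real : map_mx Num.conj (cconj X) = cconj X;
  cconj_herm : (cconj X)^t* = cconj X;
  cconj_sq : cconj X *m cconj X = 1%:M;
  cconj_cliff :
    map_mx Num.conj (cliff X 0) *m cconj X = - e *: (cconj X *m cliff X 1);
  grad_comm : grad X = - 'i *: commutator (cliff X 0) (cliff X 1) }.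

Variables (e : C) (X : spinor_data C).
Hypotheses (e_sign : e = 1 \/ e = - 1) (XP : real_clifford e X).
Local Notation C0 := (cliff X 0).
Local Notation C1 := (cliff X 1).
Local Notation K := (commutator C0 C1).

(** Anticommutation gives K = 2 C^0 C^1 = - 2 C^1 C^0, and 2 (C^i)^2 = 1. *)
Lemma commutator_mul_cliff : K *m C0 = - C1 /\ K *m C1 = C0.
Proof.
have sq := cliff_sq XP; have anti := cliff_anti XP.
have KE : K = 2 *: (C0 *m C1) by rewrite scaler_nat mulr2n {2}anti.
have half (M : 'M[C]_2) : 2 *: (M *m 2^-1%:M) = M.
  by rewrite mul_mx_scalar scalerA divff ?pnatr_eq0 // scale1r.
split; last by rewrite KE -scalemxAl -mulmxA sq half.
by rewrite KE anti -scalemxAl mulNmx -mulmxA sq scalerN half.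
Qed.

(** The braiding is K on the first index and - K on the second, so multiplying
    it by C^i exchanges the two Clifford matrices: the right multiplications
    by theta come with the opposite index. *)
Lemma dirac_swap psi : dirac X psi =
  (theta 0 0 *: psi + rmul psi (theta 0 1)) *m central C0
    + (theta 0 1 *: psi + rmul psi (theta 0 0)) *m central C1.
Proof.
have [KC0 KC1] := commutator_mul_cliff.
rewrite dirac_inner; last exact: conn_inner XP.
have braidE i j : braid X i j *m cliff X j =
    (if i == j then (if j == 0 then - C1 else - C0) else 0).
  rewrite (braid_comm XP); move: i j; elim/ord2_ind; elim/ord2_ind;
  by rewrite !mxE /= ?scale0r ?mul0mx ?scale1r ?scaleN1r ?mulNmx ?KC0 ?KC1.
rewrite !sum_ord2 !braidE /= !centralN central0.
rewrite !mulmx0 !mulmxN add0r addr0 !mulmxDl opprD !opprK.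
by rewrite [X in _ + X]addrC addrACA; congr (_ + _); rewrite addrC.
Qed.

(** The operators a (x) 1 + 1 (x) b of the algebra acting on both sides. *)
Definition bimult (a b : alg) (x : spinor) : spinor := a *: x + rmul x b.

Lemma bimultD a b x y : bimult a b (x + y) = bimult a b x + bimult a b y.
Proof. by rewrite /bimult scalerDr rmulD addrACA. Qed.

Lemma bimult_scal a b z x : bimult a b (z%:M *: x) = z%:M *: bimult a b x.
Proof. by rewrite /bimult rmulZ scalerDr !scalerA scale_algE -scale_algEr. Qed.

Lemma bimult_central a b M x :
  bimult a b (x *m central M) = bimult a b x *m central M.
Proof. by rewrite /bimult rmul_central mulmxDl scalemxAl. Qed.

Lemma star_bimult a b x : star (bimult a b x) = bimult (b^t*) (a^t*) (star x).
Proof. by rewrite /bimult starD starZ star_rmul addrC. Qed.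

Lemma hip_bimult a b x y :
  hip (bimult a b x) y = hip x (bimult (a^t*) (b^t*) y).
Proof. by rewrite /bimult hipDl hipDr hip_lmult hip_rmul. Qed.

(** The components of i theta, which are hermitian whereas those of theta are
    antihermitian. *)
Definition hpauli (i : 'I_2) : alg := - 2^-1 *: pauli C i.
Local Notation h := hpauli.

Lemma hpauli_herm i : (h i)^t* = h i.
Proof.
rewrite trmxCZ rmorphN fmorphV rmorph_nat; congr (_ *: _).
by move: i; elim/ord2_ind; rewrite /= ?mx2E; congr mx2;
  rewrite ?(rmorph0, rmorph1, rmorphN) //= ?conjCi ?opprK.
Qed.

Lemma i_vartheta i : 'i%:M * theta 0 i = h i.
Proof.
by rewrite scale_algE mxE scalerA /hpauli; congr (_ *: _); field: (Ci_sq C).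
Qed.

Lemma diracD_swap psi : diracD X psi =
  bimult (h 0) (h 1) psi *m central C0 + bimult (h 1) (h 0) psi *m central C1.
Proof.
have i_swap i j :
    'i%:M *: (theta 0 i *: psi + rmul psi (theta 0 j)) = bimult (h i) (h j) psi.
  rewrite /bimult scalerDr scalerA i_vartheta; congr (_ + _).
  by rewrite -rmulC rmulA scale_algEr -scale_algE i_vartheta.
by rewrite /diracD dirac_swap scalerDr !scalemxAl !i_swap.
Qed.

Lemma charge_conjE psi : charge_conj X psi = star psi *m central (cconj X).
Proof.
apply/rowP => be; rewrite mxE mulmx_centralE; apply: eq_bigr => al _.
by rewrite [star _ _ _]mxE.
Qed.

Lemma gammaE psi : gamma X psi = psi *m central (grad X).
Proof. by apply/rowP => be; rewrite mxE mulmx_centralE. Qed.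

Lemma scalar_trmxC (z : C) : (z%:M : alg)^t* = (z^*)%:M.
Proof. by rewrite tr_scalar_mx map_scalar_mx. Qed.

Lemma charge_conj_lmult a psi :
  charge_conj X (a *: psi) = rmul (charge_conj X psi) (a^t*).
Proof. by rewrite !charge_conjE starZ rmul_central. Qed.

Lemma charge_conjD x y :
  charge_conj X (x + y) = charge_conj X x + charge_conj X y.
Proof. by rewrite !charge_conjE starD mulmxDl. Qed.

Lemma charge_conj_central M N x :
    map_mx Num.conj M *m cconj X = cconj X *m N ->
  charge_conj X (x *m central M) = charge_conj X x *m central N.
Proof.
by move=> MN; rewrite !charge_conjE star_central -!mulmxA -!centralM MN.
Qed.

Lemma charge_conjK : involutive (charge_conj X).
Proof.
move=> x; rewrite !charge_conjE star_central starK (cconj_real XP).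
by rewrite -mulmxA -centralM (cconj_sq XP) central1 mulmx1.
Qed.

Lemma charge_conj_antilinear : antilinear (charge_conj X).
Proof.
move=> z x y; rewrite charge_conjD charge_conj_lmult scalar_trmxC.
by rewrite rmulC.
Qed.

Lemma charge_conj_antiisometry : antiisometry (charge_conj X).
Proof.
move=> x y; rewrite !charge_conjE hip_central -mulmxA -centralM (cconj_herm XP).
by rewrite (cconj_sq XP) central1 mulmx1 hip_star.
Qed.

Lemma diracD_clinear : clinear (diracD X).
Proof.
move=> z x y; rewrite !diracD_swap !bimultD !bimult_scal.
rewrite !(mulmxDl (_ *: bimult _ _ _)) -!scalemxAl [LHS]addrACA.
by rewrite [in RHS]scalerDr.
Qed.

Lemma diracD_self_adjoint : self_adjoint (diracD X).
Proof.
move=> x y; rewrite !diracD_swap hipDl hipDr !hip_central !hip_bimult.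
by rewrite !hpauli_herm !(cliff_herm XP) !bimult_central.
Qed.

Lemma e_sq : e * e = 1.
Proof. by case: e_sign => ->; rewrite ?mulrNN mulr1. Qed.

Lemma e_real : e^* = e.
Proof. by case: e_sign => ->; rewrite ?rmorphN rmorph1. Qed.

Lemma cconj_cliff_swap :
  map_mx Num.conj C1 *m cconj X = - e *: (cconj X *m C0).
Proof.
have CJ := congr1 (map_mx Num.conj) (cconj_cliff XP).
rewrite map_mxZ !map_mxM (cconj_real XP) rmorphN /= e_real -map_mx_comp in CJ.
rewrite (eq_map_mx _ (@conjCK C)) map_mx_id // in CJ.
rewrite -[C0 in RHS]mulmx1 -(cconj_sq XP) (mulmxA C0) CJ -scalemxAl -scalemxAr.
by rewrite scalerA mulrNN e_sq scale1r !mulmxA (cconj_sq XP) mul1mx.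
Qed.

Lemma charge_conj_bimult a b x :
  charge_conj X (bimult a b x) = bimult (b^t*) (a^t*) (charge_conj X x).
Proof. by rewrite !charge_conjE star_bimult bimult_central. Qed.

(** J turns h_i psi + psi h_j into h_j (J psi) + (J psi) h_i and C^0, C^1 into
    - e C^1, - e C^0, so it exchanges the two terms of D. *)
Lemma charge_conj_diracD x :
  charge_conj X (diracD X x) = (- e)%:M *: diracD X (charge_conj X x).
Proof.
have swap i j M N : map_mx Num.conj M *m cconj X = - e *: (cconj X *m N) ->
    charge_conj X (bimult (h i) (h j) x *m central M) =
    (- e)%:M *: (bimult (h j) (h i) (charge_conj X x) *m central N).
  rewrite scalemxAr => /charge_conj_central ->.
  by rewrite charge_conj_bimult !hpauli_herm mulmx_centralZ.
rewrite !diracD_swap charge_conjD scalerDr addrC.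
by rewrite (swap _ _ _ _ (cconj_cliff XP)) (swap _ _ _ _ cconj_cliff_swap).
Qed.

(** J b J^-1 is a right multiplication, as J is an involution. *)
Lemma charge_conj_lmult_conj b x :
  charge_conj X (b *: charge_conj X x) = rmul x (b^t*).
Proof. by rewrite charge_conj_lmult charge_conjK. Qed.

Lemma zeroth_order_condition a b x :
  opcomm (lmult a) (charge_conj X \o lmult b \o charge_conj X) x = 0.
Proof. by rewrite /opcomm /lmult /= !charge_conj_lmult_conj rmulZ subrr. Qed.

(** The right multiplications in D commute with a and disappear. *)
Lemma opcomm_diracD a x : opcomm (diracD X) (lmult a) x =
  ((h 0 * a - a * h 0) *: x) *m central C0
    + ((h 1 * a - a * h 1) *: x) *m central C1.
Proof.
have bimult_comm b b' : bimult b b' (a *: x) - a *: bimult b b' x =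
    (b * a - a * b) *: x.
  by rewrite /bimult rmulZ scalerDr opprD addrACA subrr addr0 !scalerA scalerBl.
rewrite /opcomm /lmult !diracD_swap scalerDr opprD addrACA !scalemxAl.
by rewrite -!mulmxBl !bimult_comm.
Qed.

Lemma first_order_condition a b x :
  opcomm (opcomm (diracD X) (lmult a))
    (charge_conj X \o lmult b \o charge_conj X) x = 0.
Proof.
rewrite [LHS]/opcomm /= /lmult !charge_conj_lmult_conj -/(lmult a).
by rewrite !opcomm_diracD rmulD !rmul_central !rmulZ subrr.
Qed.

Lemma real_spectral_triple_clifford :
  real_spectral_triple 1 (- e) (diracD X) (charge_conj X).
Proof.
split.
- by split; [exact: diracD_clinear | exact: diracD_self_adjoint].
- by split; [exact: charge_conj_antilinear | exact: charge_conj_antiisometry].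
- exists (charge_conj X); split; try exact: charge_conjK.
    exact: zeroth_order_condition.
  exact: first_order_condition.
- by move=> x; rewrite charge_conjK scale1r.
- exact: charge_conj_diracD.
Qed.

Lemma mul_cliff0K (M : 'M[C]_2) : M *m C0 *m C0 = 2^-1 *: M.
Proof. by rewrite -mulmxA (cliff_sq XP) mul_mx_scalar. Qed.

Lemma commutator_herm : K^t* = - K.
Proof.
by rewrite /commutator trmxCD trmxCN !trmxC_mul !(cliff_herm XP) opprB.
Qed.

(** These are the adjoints of the products K C^i, as K is antihermitian. *)
Lemma cliff_mul_commutator : C0 *m K = C1 /\ C1 *m K = - C0.
Proof.
have [KC0 KC1] := commutator_mul_cliff.
have dual i : cliff X i *m K = - (K *m cliff X i)^t*.
  by rewrite trmxC_mul commutator_herm (cliff_herm XP) mulmxN opprK.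
rewrite !dual KC0 KC1 (cliff_herm XP); split=> //.
by rewrite trmxCN (cliff_herm XP) opprK.
Qed.

(** K exchanges C^0 and C^1 up to sign, so K K C^0 = - C^0, and C^0 is
    invertible. *)
Lemma commutator_sq : K *m K = - 1%:M.
Proof.
have [KC0 KC1] := commutator_mul_cliff.
have inv2 : (2^-1 : C) != 0 by rewrite invr_eq0 pnatr_eq0.
apply: (scalerI inv2); rewrite -mul_cliff0K -[K *m K *m C0]mulmxA KC0.
by rewrite mulmxN KC1 mulNmx (cliff_sq XP) scalerN scalemx1.
Qed.

Lemma grad_herm : (grad X)^t* = grad X.
Proof.
rewrite (grad_comm XP) trmxCZ commutator_herm rmorphN /= conjCi opprK.
by rewrite scalerN scaleNr.
Qed.

Lemma grad_sq : grad X *m grad X = 1%:M.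
Proof.
rewrite (grad_comm XP) -scalemxAl -scalemxAr commutator_sq scalerA mulrNN Ci_sq.
by rewrite scaleN1r opprK.
Qed.

Lemma grad_cliff i : cliff X i *m grad X = - (grad X *m cliff X i).
Proof.
have [KC0 KC1] := commutator_mul_cliff; have [CK0 CK1] := cliff_mul_commutator.
rewrite (grad_comm XP) -scalemxAl -scalemxAr -scalerN; congr (_ *: _).
by move: i; elim/ord2_ind; rewrite ?(KC0, KC1, CK0, CK1) ?opprK.
Qed.

Lemma cconj_grad : map_mx Num.conj (grad X) *m cconj X = cconj X *m grad X.
Proof.
have CJ0 := cconj_cliff XP; have CJ1 := cconj_cliff_swap.
have KJ : map_mx Num.conj K *m cconj X = - (cconj X *m K).
  rewrite /commutator map_mxB !map_mxM mulmxBl -!mulmxA CJ0 CJ1.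
  rewrite -!scalemxAr ![map_mx _ _ *m (_ *m _)]mulmxA CJ0 CJ1.
  rewrite -!scalemxAl !scalerA mulrNN e_sq !scale1r -!mulmxA -mulmxBr.
  by rewrite -[RHS]mulmxN opprB.
rewrite (grad_comm XP) map_mxZ -scalemxAl KJ -scalemxAr.
by rewrite rmorphN /= conjCi opprK scalerN scaleNr.
Qed.

Lemma charge_conj_gamma x :
  charge_conj X (gamma X x) = gamma X (charge_conj X x).
Proof. by rewrite !gammaE; apply: charge_conj_central cconj_grad. Qed.

Lemma even_structure_clifford :
  even_structure 1 (diracD X) (charge_conj X) (gamma X).
Proof.
split.
- split=> [z x y | x y]; rewrite !gammaE; first by rewrite mulmxDl scalemxAl.
  by rewrite hip_central grad_herm.
- by move=> a x; rewrite !gammaE scalemxAl.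
- by move=> x; rewrite !gammaE -mulmxA -centralM grad_sq central1 mulmx1.
- move=> x; rewrite !gammaE !diracD_swap !bimult_central (mulmxDl (_ *m _)).
  by rewrite opprD -!mulmxA -!centralM !grad_cliff !centralN !mulmxN.
- by move=> x; rewrite charge_conj_gamma scale1r.
Qed.

End CliffordRelations.

(** * The two sets of spinor data *)

Section TheData.
Local Open Scope sesquilinear_scope.
Variables (C : numClosedFieldType) (e : C).
Hypothesis e_sign : e = 1 \/ e = - 1.

Local Notation s := (sqrtC (2 : C)).
Local Notation p1 := (pauli1 C).
Local Notation p2 := (pauli2 C).
Local Notation p3 := (pauli3 C).

Lemma sqrt2_sq : s * s = 2. Proof. by rewrite -expr2 sqrtCK. Qed.

Lemma sqrt2_neq0 : s != 0. Proof. by rewrite sqrtC_eq0 pnatr_eq0. Qed.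

Lemma sqrt2_real : s^* = s.
Proof. by rewrite conj_Creal // ger0_real // sqrtC_ge0 ler0n. Qed.

Lemma conj_coef :
  [/\ (2^-1 : C)^* = 2^-1, (e / 2)^* = e / 2, s^-1^* = s^-1
    & (e / s)^* = e / s].
Proof.
have half : (2^-1 : C)^* = 2^-1 by rewrite fmorphV rmorph_nat.
have sV : s^-1^* = s^-1 by rewrite fmorphV /= sqrt2_real.
by rewrite !rmorphM /= (e_real e_sign) half sV.
Qed.

Lemma pauli_herm : [/\ p1^t* = p1, p2^t* = p2 & p3^t* = p3].
Proof.
by split; rewrite ?mx2E ?(rmorph0, rmorph1, rmorphN1, rmorphN) //=
  ?conjCi ?opprK.
Qed.

Lemma pauli_real : map_mx Num.conj p1 = p1 /\ map_mx Num.conj p3 = p3.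
Proof. by split; rewrite ?mx2E ?(rmorph0, rmorph1, rmorphN1). Qed.

Lemma commutator_a :
  commutator (cliff_a e 0) (cliff_a e 1) = (- 'i * e) *: p2.
Proof.
rewrite /commutator /cliff_a /= ?mx2E.
by congr mx2; field: (Ci_sq C).
Qed.

Lemma commutator_b :
  commutator (cliff (data_b e) 0) (cliff (data_b e) 1) = (- 'i * e) *: p2.
Proof.
have s0 := sqrt2_neq0; rewrite /commutator /= ?mx2E.
by congr mx2; field: sqrt2_sq (Ci_sq C).
Qed.

Lemma data_a_clifford : real_clifford e (data_a e).
Proof.
have ee := e_sq e_sign.
have [c1 c2 _ _] := conj_coef.
have [h1 h2 h3] := pauli_herm; have [r1 r3] := pauli_real.
split.
- by elim/ord2_ind; rewrite /= /cliff_a /= trmxCZ trmxCD ?trmxCN ?c1 ?c2 h1 h3.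
- elim/ord2_ind; rewrite /= /cliff_a /= ?mx2E;
    by congr mx2; field: ee.
- by rewrite /= /cliff_a /= ?mx2E; congr mx2; field.
- by [].
- by [].
- exact: r3.
- exact: h3.
- by rewrite /= ?mx2E; congr mx2; ring.
- rewrite /= /cliff_a /= map_mxZ /= c1 map_mxB r1 r3 ?mx2E.
  by congr mx2; field: ee.
- rewrite commutator_a /= scalerA; congr (_ *: _).
  by rewrite mulrA mulrNN Ci_sq mulN1r.
Qed.

Lemma data_b_clifford : real_clifford e (data_b e).
Proof.
have ee := e_sq e_sign.
have [_ _ c1 c2] := conj_coef; have s0 := sqrt2_neq0; have ss := sqrt2_sq.
have [h1 h2 h3] := pauli_herm; have [r1 r3] := pauli_real.
split.
- by elim/ord2_ind; rewrite /= trmxCZ ?c1 ?c2 ?h1 ?h3.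
- elim/ord2_ind; rewrite /= ?mx2E;
    by congr mx2; field: ee ss.
- by rewrite /= ?mx2E; congr mx2; field.
- by move=> i j; rewrite commutator_b -commutator_a.
- by [].
- by rewrite /= map_mxZ /= c1 map_mxB r1 r3.
- by rewrite /= trmxCZ trmxCD trmxCN c1 h1 h3.
- by rewrite /= ?mx2E; congr mx2; field: ss.
- rewrite /= map_mxZ /= c1 r1 ?mx2E.
  by congr mx2; field: ee ss.
- rewrite commutator_b /= scalerA; congr (_ *: _).
  by rewrite mulrA mulrNN Ci_sq mulN1r.
Qed.

Lemma dirac_data_b (psi : bimod C) (be : 'I_2) :
  dirac (data_b e) psi 0 be =
    ('i / (2 * s)) *:
      (\sum_(al < 2)
         (p1 al be *: (p1 * psi 0 al + psi 0 al * p2)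
          + e *: (p3 al be *: (psi 0 al * p1 + p2 * psi 0 al)))).
Proof.
have thetaE i : vartheta C 0 i = ('i / 2) *: pauli C i by rewrite mxE.
rewrite (dirac_swap (data_b_clifford)) mxE !mulmx_centralE -big_split.
rewrite scaler_sumr; apply: eq_bigr => al _ /=.
rewrite ![((_ *: _) : 'M[C]_2) al be]mxE.
rewrite ![(_ + rmul _ _) _ _]mxE ![(_ *: psi) _ _]mxE ![rmul _ _ _ _]mxE.
rewrite !thetaE.
rewrite -!scalerAl -!scalerAr -!(scalerDr ('i / 2)) [RHS]scalerDr !scalerA.
have s0 := sqrt2_neq0.
have -> : s^-1 * p1 al be * ('i / 2) = 'i / (2 * s) * p1 al be.
  by field; rewrite s0.
have -> : e / s * p3 al be * ('i / 2) = 'i / (2 * s) * (e * p3 al be).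
  by field; rewrite s0.
by rewrite (addrC (pauli C 1 * _)) (mulrA _ e).
Qed.

(** The cosine and the sine of pi / 8, characterised by the norm and by
    cos (pi / 4) = sin (pi / 4) = 1 / sqrt 2. *)
Lemma rotation_coef : exists c t : C,
  [/\ c^* = c /\ t^* = t, c * c + t * t = 1, c * c - t * t = s^-1
    & 2 * (c * t) = s^-1].
Proof.
have s_gt0 : 0 < s by rewrite sqrtC_gt0 ltr0n.
(* Half-angle formulas: c^2 = (1 + cos (pi / 4)) / 2 and
   t = sin (pi / 4) / (2 c). *)
pose c := sqrtC ((1 + s^-1) / 2).
have c_gt0 : 0 < c.
  by rewrite sqrtC_gt0 divr_gt0 ?ltr0n // addr_gt0 ?ltr01 // invr_gt0.
have cc : c * c = (1 + s^-1) / 2 by rewrite -expr2 sqrtCK.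
pose t := s^-1 / (2 * c).
have t_gt0 : 0 < t by rewrite divr_gt0 ?invr_gt0 // mulr_gt0 // ltr0n.
have s0 : s != 0 by rewrite gt_eqF.
have c0 : c != 0 by rewrite gt_eqF.
have ct : c * t = s^-1 / 2 by rewrite /t; field; rewrite c0 s0.
have tt : t * t = (1 - s^-1) / 2.
  apply: (mulfI (mulf_neq0 c0 c0)).
  by rewrite mulrACA ct cc; field: (sqrt2_sq).
exists c, t; split.
- by split; apply/CrealP/ger0_real/ltW.
- by rewrite cc tt; field.
- by rewrite cc tt; field.
- by rewrite ct; field.
Qed.

Lemma data_unitarily_equivalent : unitarily_equivalent (data_a e) (data_b e).
Proof.
have [c [t [[cR tR] norm1 sV_diff sV_prod]]] := rotation_coef.
have cc : c * c = t * t + 2 * (c * t) by rewrite sV_prod -sV_diff addrC subrK.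
have cc1 : c * c = 1 - t * t by rewrite -norm1 addrK.
pose u := mx2 c t (- t) c; pose v := mx2 c (- t) t c.
have uC : u^t* = v by rewrite /u mx2E mx2_map rmorphN /= cR tR.
have uR : map_mx Num.conj u = u by rewrite /u mx2E rmorphN /= cR tR.
have uv : u *m v = 1%:M by rewrite ?mx2E; congr mx2; ring: cc1.
have u_unitary : u \is unitarymx by apply/unitarymxP; rewrite uC.
have uV : invmx u = v by rewrite invmx_unitary.
have up2 : u *m p2 *m v = p2 by rewrite ?mx2E; congr mx2; ring: cc1.
have braid_u i j : u *m braid_a e i j *m v = braid_a e i j.
  have -> : braid_a e i j = zeta C i j *: ((- 'i * e) *: p2).
    by rewrite -commutator_a.
  by rewrite scalerA -scalemxAr -scalemxAl up2.
(* Once 1 / sqrt 2 is replaced by 2 c t, the remaining identities are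
   polynomial in c and t modulo c^2 - t^2 = 2 c t. *)
exists u => //; rewrite /= uV uR -sV_prod; split.
- by elim/ord2_ind; rewrite /cliff_a /= ?mx2E; congr mx2; field: cc.
- move=> i; rewrite -/(central u) -/(central v) inner_conn_conjugate //.
  rewrite !inner_connE; congr (_ - _).
  by apply: eq_bigr => j _; rewrite braid_u.
- by move=> i j; rewrite braid_u.
- by rewrite ?mx2E; congr mx2; ring: cc.
- by rewrite -scalemxAr -scalemxAl up2.
Qed.

End TheData.

Theorem corollary4p9 (R : realType) (eps' : R[i])
    (heps' : eps' = 1 \/ eps' = -1) :
  [/\ quantum_metric (metric_M2 R[i]) /\
      (quantum_levi_civita (metric_M2 R[i]) (@nabla_M2 R[i]) /\
       flat (@nabla_M2 R[i])),
      unitarily_equivalent (data_a eps') (data_b eps'),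
      forall X : spinor_data R[i], X = data_a eps' \/ X = data_b eps' ->
        [/\ bimodule_connection (nablaS X) (braidS X),
            forall psi : bimod R[i], charge_conj X (charge_conj X psi) = psi,
            forall psi : bimod R[i], charge_conj X (gamma X psi) =
                                     gamma X (charge_conj X psi),
            eps' = -1 ->
              spectral_triple_KO0 (diracD X) (charge_conj X) (gamma X)
          & eps' = 1 -> spectral_triple_KO1 (diracD X) (charge_conj X)]
    & forall (psi : bimod R[i]) (be : 'I_2),
        dirac (data_b eps') psi 0 be =
          ('i / (2 * sqrtC 2)) *:
            (\sum_(al < 2)
               (pauli1 R[i] al be *:
                  (pauli1 R[i] * psi 0 al + psi 0 al * pauli2 R[i])
                + eps' *: (pauli3 R[i] al be *:
                  (psi 0 al * pauli1 R[i] + pauli2 R[i] * psi 0 al))))].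
Proof.
split.
- split; first exact: metric_M2_quantum_metric.
  split; last exact: nabla_M2_flat.
  exists (@flip R[i]); split.
  + exact: nabla_M2_connection.
  + exact: nabla_M2_torsion_free.
  + exact: nabla_M2_metric.
- exact: data_unitarily_equivalent.
- move=> X dataX; have XP : real_clifford eps' X.
    by case: dataX => ->; [apply: data_a_clifford | apply: data_b_clifford].
  have triple := real_spectral_triple_clifford heps' XP.
  split.
  + by apply: nablaS_connection; apply: conn_inner XP.
  + exact: charge_conjK XP.
  + exact: charge_conj_gamma heps' XP.
  + move=> eN1; split; last exact: even_structure_clifford heps' XP.
    by rewrite eN1 opprK in triple.
  + by move=> e1; rewrite e1 in triple.
- exact: dirac_data_b.
Qed.
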